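(* Consider the cyber-physical descriptor system with an additive signal $w(t)=[w_x(t)^{\mathsf T}\;w_y(t)^{\mathsf T}]^{\mathsf T}$ injected by an active monitor, $$E\dot x(t)=Ax(t)+B_Ku_K(t)+w_x(t),\qquad y(t)=Cx(t)+D_Ku_K(t)+w_y(t),$$ where $E,A\in\mathbb{R}^{n\times n}$, $C\in\mathbb{R}^{p\times n}$, and $B_K,D_K$ are the submatrices with columns in $K\subseteq\{1,\dots,n+p\}$ of $B=[I_n\;\,0]\in\mathbb{R}^{n\times(n+p)}$ and $D=[0\;\,I_p]\in\mathbb{R}^{p\times(n+p)}$. Then the existence of undetectable (respectively unidentifiable) attacks does not depend upon the signal $w$: for any two signals $w,w'$, there exists an undetectable (respectively unidentifiable) attack in the presence of $w$ if and only if there exists one in the presence of $w'$. Moreover, undetectable (respectively unidentifiable) attacks can be designed independently of $w$: if undetectable (respectively unidentifiable) attacks exist, then there is an attack, not depending on $w$, that is undetectable (respectively unidentifiable) in the presence of every signal $w$.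
   Context: Standing assumptions: $E$ may be singular; the pair $(E,A)$ is regular, i.e. $\det(sE-A)$ does not vanish identically in $s$; initial conditions are consistent with the inputs acting on the system (the total input to the state equation plus $Ax(0)$ is orthogonal to $\ker(E^{\mathsf T})$); input signals are smooth. Attacks: $u(t)\in\mathbb{R}^{n+p}$ is an unknown attack signal. For an attack set $K\subseteq\{1,\dots,n+p\}$, only and all the entries of $u$ indexed by $K$ are nonzero over time (the component $u_i$ is not the identically zero signal exactly when $i\in K$). The attack mode $u_K(t)$ is the subvector of $u(t)$ indexed by $K$, and $(B_Ku_K,D_Ku_K)$ is called an attack; undetectable and unidentifiable attacks are nonzero attacks. An active monitor is deterministic, knows $E,A,C$ and $y(t)$ for all $t\in\mathbb{R}_{\ge0}$, and injects the signal $w$ (unknown to the attacker). Let $y(x,u,w,t)$ denote the output generated from initial condition $x$ by attack $u$ and monitoring signal $w$. In the presence of $w$, an attack $u_K$ is undetectable if and only if $y(x,u_K,w,t)=y(\bar x,0,w,t)$ for all $t\in\mathbb{R}_{\ge0}$, for some initial conditions $x,\bar x$; it is unidentifiable if and only if $y(x,u_K,w,t)=y(\bar x,u_R,w,t)$ for all $t\in\mathbb{R}_{\ge0}$, for some initial conditions $x,\bar x$ and some attack $(B_Ru_R,D_Ru_R)$ with $|R|\le|K|$, $R\neq K$. *)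

(* Defs.v *)
From HB Require Import structures.
From mathcomp Require Import all_boot all_order all_algebra.
From mathcomp Require Import all_classical all_reals all_analysis.

Set Implicit Arguments.
Unset Strict Implicit.
Unset Printing Implicit Defensive.

Import Order.TTheory GRing.Theory Num.Theory.
Import numFieldNormedType.Exports.

Local Open Scope classical_set_scope.
Local Open Scope ring_scope.

(* Signals are functions [R -> V] of which only the values at times [t >= 0]
   are meaningful: no definition below inspects a signal at negative times. *)

Section signals.
Variables (R : realType) (V : normedModType R).

(* The derivative relative to the half-line [t >= 0]: two-sided for [0 < t],
   right derivative at [t = 0]. *)
Definition has_derivative (f : R -> V) (t : R) (v : V) : Prop :=
  (s - t)^-1 *: (f s - f t) @[s --> within [set s | 0 <= s] t^'] --> v.

Definition smooth_signal (f : R -> V) : Prop :=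
  exists g : nat -> R -> V, g 0%N = f /\
    forall k t, 0 <= t -> has_derivative (g k) t (g k.+1 t).

Definition nonzero_signal (f : R -> V) : Prop := exists t, 0 <= t /\ f t != 0.

End signals.

Section descriptor_system.
Variables (R : realType) (n p : nat).
Implicit Types (E A : 'M[R]_n) (C : 'M[R]_(p, n)) (K : {set 'I_(n + p)}).

Definition regular_pencil E A : Prop :=
  \det ('X *: map_mx polyC E - map_mx polyC A) != 0 :> {poly R}.

Definition attack_B : 'M[R]_(n, n + p) := row_mx 1%:M 0.
Definition attack_D : 'M[R]_(p, n + p) := row_mx 0 1%:M.

(* [enum_val] lists the elements of [K] in increasing order. *)
Definition cols_in (m : nat) (M : 'M[R]_(m, n + p)) K : 'M[R]_(m, #|K|) :=
  colsub (fun j : 'I_#|K| => enum_val j) M.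

Definition state_input K (u : R -> 'cV[R]_#|K|) (w : R -> 'cV[R]_(n + p))
    (t : R) : 'cV[R]_n :=
  cols_in attack_B K *m u t + usubmx (w t).

Definition output_input K (u : R -> 'cV[R]_#|K|) (w : R -> 'cV[R]_(n + p))
    (t : R) : 'cV[R]_p :=
  cols_in attack_D K *m u t + dsubmx (w t).

(* [A x0 + f(0)] is orthogonal to [ker E^T], for [f] the total input. *)
Definition consistent E A (x0 : 'cV[R]_n) (f : R -> 'cV[R]_n) : Prop :=
  forall v : 'cV[R]_n, E^T *m v = 0 -> v^T *m (A *m x0 + f 0) = 0.

Definition state_trajectory E A (x0 : 'cV[R]_n) (f x : R -> 'cV[R]_n) : Prop :=
  x 0 = x0 /\
  forall t, 0 <= t -> exists dx,
    has_derivative x t dx /\ E *m dx = A *m x t + f t.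

(* [generates_output E A C x0 u w y] states y(x0, u, w, t) = y(t) for all
   t >= 0. It is a relation because not every [x0] starts a trajectory when
   [E] is singular; for a regular pencil the trajectory, if any, is unique. *)
Definition generates_output E A C K (x0 : 'cV[R]_n) (u : R -> 'cV[R]_#|K|)
    (w : R -> 'cV[R]_(n + p)) (y : R -> 'cV[R]_p) : Prop :=
  consistent E A x0 (state_input u w) /\
  exists x, state_trajectory E A x0 (state_input u w) x /\
    forall t, 0 <= t -> y t = C *m x t + output_input u w t.

(* Exactly the entries indexed by [K] are nonzero signals. The zero attack
   ([K = set0]) is not excluded here. *)
Definition attack_mode K (u : R -> 'cV[R]_#|K|) : Prop :=
  smooth_signal u /\ forall i, nonzero_signal (fun t => u t i 0).

Definition undetectable E A C K (w : R -> 'cV[R]_(n + p))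
    (u : R -> 'cV[R]_#|K|) : Prop :=
  attack_mode u /\ nonzero_signal u /\
  exists (x xbar : 'cV[R]_n) (y : R -> 'cV[R]_p),
    generates_output E A C x u w y /\
    generates_output E A C xbar (fun=> 0 : 'cV[R]_#|K|) w y.

Definition unidentifiable E A C K (w : R -> 'cV[R]_(n + p))
    (u : R -> 'cV[R]_#|K|) : Prop :=
  attack_mode u /\ nonzero_signal u /\
  exists (K' : {set 'I_(n + p)}) (u' : R -> 'cV[R]_#|K'|),
    (#|K'| <= #|K|)%N /\ K' <> K /\ attack_mode u' /\
    exists (x xbar : 'cV[R]_n) (y : R -> 'cV[R]_p),
      generates_output E A C x u w y /\ generates_output E A C xbar u' w y.

End descriptor_system.

(* Main.v *)
From HB Require Import structures.
Require Import Defs.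
From mathcomp Require Import all_boot all_order all_algebra.
From mathcomp Require Import all_classical all_reals all_analysis.
From mathcomp Require Import complex ring lra zify.

(** The difference of two trajectories driven by the same [w] solves the system
    driven by the attacks alone, so a collision of outputs under [w] becomes one
    under [w'] as soon as the system forced by the second attack and [w'] has
    some trajectory. For a regular pencil it does: if [z] solves
    [det(E d/dt - A) z_j = f_j] for every [j], then [x = adj(E d/dt - A) z]
    solves [E x' = A x + f]. The scalar equations are solved by variation of
    constants, one real linear or quadratic factor of the determinant at a
    time. *)

Set Implicit Arguments.
Unset Strict Implicit.
Unset Printing Implicit Defensive.

Import Order.TTheory GRing.Theory Num.Theory.
Import numFieldNormedType.Exports.

Local Open Scope classical_set_scope.
Local Open Scope ring_scope.

(** * Calculus of derivatives relative to the half-line of nonnegative times *)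

Section HalfLineDerivative.
Context {R : realType}.
Implicit Types (V : normedModType R) (t : R).

Let halfline_dnbhs t : set_system R := within [set s | 0 <= s] t^'.

Lemma halfline_cvg V (f g : R -> V) t (l : V) :
  (forall s, 0 <= s -> s != t -> f s = g s) ->
  f s @[s --> halfline_dnbhs t] --> l -> g s @[s --> halfline_dnbhs t] --> l.
Proof.
move=> fg; apply: cvg_trans; apply: near_eq_cvg.
rewrite !near_withinE; near=> s => st s0; exact: fg.
Unshelve. all: by end_near. Qed.

Lemma has_derivative_cst V (c : V) t : has_derivative (fun=> c) t 0.
Proof.
apply: (halfline_cvg (f := fun=> 0)); last exact: cvg_cst.
by move=> s _ _; rewrite subrr scaler0.
Qed.

Lemma has_derivativeD V (f g : R -> V) t v w :
  has_derivative f t v -> has_derivative g t w ->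
  has_derivative (fun s => f s + g s) t (v + w).
Proof.
move=> fv gw; apply: (halfline_cvg _ (cvgD fv gw)) => s _ _ /=.
by rewrite opprD addrACA -scalerDr.
Qed.

Lemma has_derivativeZ V (c : R) (f : R -> V) t v :
  has_derivative f t v -> has_derivative (fun s => c *: f s) t (c *: v).
Proof.
move=> fv; apply: (halfline_cvg _ (cvgZ (cvg_cst c) fv)) => s _ _ /=.
by rewrite -scalerBr !scalerA mulrC.
Qed.

Lemma has_derivativeN V (f : R -> V) t v :
  has_derivative f t v -> has_derivative (fun s => - f s) t (- v).
Proof.
move=> /(has_derivativeZ (c := -1)).
by rewrite scaleN1r; under eq_fun do rewrite scaleN1r.
Qed.

Lemma has_derivativeMl (c : R) (f : R -> R) t v :
  has_derivative f t v -> has_derivative (fun s => c * f s) t (c * v).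
Proof. exact: has_derivativeZ. Qed.

Lemma has_derivative_sum V (I : Type) (r : seq I) (f : I -> R -> V) t v :
  (forall i, has_derivative (f i) t (v i)) ->
  has_derivative (fun s => \sum_(i <- r) f i s) t (\sum_(i <- r) v i).
Proof.
move=> fv; elim: r => [|i r ih].
  rewrite big_nil; under eq_fun do rewrite big_nil.
  exact: has_derivative_cst.
rewrite big_cons; under eq_fun do rewrite big_cons.
exact: has_derivativeD.
Qed.

(** Off [t], [f s] is [s - t] times the difference quotient plus [f t], and the product tends to
    [0 * v]. *)
Lemma has_derivative_cvg (f : R -> R) t v :
  has_derivative f t v -> f s @[s --> halfline_dnbhs t] --> f t.
Proof.
move=> fv.
have st : (s - t) @[s --> halfline_dnbhs t] --> (0 : R).
  apply: cvg_within_filter; apply: cvg_within_filter.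
  by apply/cvgrPdist_lt => e e0; exists e => //= s; rewrite sub0r opprB.
rewrite -[f t]add0r -[in X in X + _](mul0r v).
apply: (halfline_cvg _ (cvgD (cvgM st fv) (cvg_cst (f t)))).
move=> s _ st0 /=.
by rewrite /GRing.scale/= mulrA divff ?subr_eq0// mul1r subrK.
Qed.

Lemma has_derivativeM (f g : R -> R) t v w :
  has_derivative f t v -> has_derivative g t w ->
  has_derivative (fun s => f s * g s) t (f t * w + v * g t).
Proof.
move=> fv gw; apply: (halfline_cvg _
  (cvgD (cvgM (has_derivative_cvg fv) gw) (cvgM fv (cvg_cst (g t))))).
by move=> s _ _ /=; rewrite /GRing.scale/=; ring.
Qed.

Lemma is_derive_has_derivative (f : R -> R) t v :
  is_derive t 1 f v -> has_derivative f t v.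
Proof.
move=> [df <-]; apply: cvg_within_filter.
have /cvgrPdist_le H := df; apply/cvgrPdist_le => e /H [/= r r0 Hr].
exists r => //= s ts st.
have := Hr (s - t); rewrite /ball_/= sub0r normrN subr_eq0 distrC => /(_ ts st).
by rewrite /GRing.scale/= mulr1 subrK.
Qed.

(** The matrix norm is the maximum of the absolute values of finitely many entries. *)
Lemma has_derivative_mxP m n (f : R -> 'M[R]_(m, n)) t v :
  has_derivative f t v <->
  forall i j, has_derivative (fun s => f s i j) t (v i j).
Proof.
split => [/cvgrPdist_le H i j|H]; apply/cvgrPdist_le => /= e e0.
- have := H _ e0; apply: filterS => s; apply: le_trans.
  rewrite [leRHS]/Num.Def.normr/= mx_normrE.
  by apply: le_trans (le_bigmax _ _ (i, j)); rewrite !mxE.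
- near=> s.
  rewrite /Num.Def.normr/= mx_normrE (bigmax_le _ (ltW e0))//= => i _.
  rewrite !mxE/=.
  move: i; near: s; apply: filter_forall => /= i.
  exact: ((cvgrPdist_le _ _).1 (H i.1 i.2)).
Unshelve. all: by end_near. Qed.

Lemma has_derivative_mulmx m n q (M : 'M[R]_(m, n))
    (f : R -> 'M[R]_(n, q)) t v :
  has_derivative f t v -> has_derivative (fun s => M *m f s) t (M *m v).
Proof.
move=> /has_derivative_mxP fv; apply/has_derivative_mxP => i j.
rewrite mxE; under eq_fun do rewrite mxE.
by apply: has_derivative_sum => k; exact: has_derivativeMl.
Qed.

(** Freezing [f] at [f 0] for negative times gives a function on the whole line. Clamping to the
    half-line never increases distances, so continuity of [f] within the half-line suffices. *)
Lemma halfline_extension_continuous (f : R -> R) :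
  (forall t, 0 <= t -> exists v, has_derivative f t v) ->
  continuous (fun s : R => f (Num.max s 0)).
Proof.
move=> df t; set a := Num.max t 0.
have a0 : 0 <= a by rewrite /a le_max lexx orbT.
have [v /has_derivative_cvg/cvgrPdist_lt fa] := df _ a0.
apply/cvgrPdist_lt => e e0.
have /= [r r0 H] := fa e e0.
exists r => //= s ts.
(* The bound [H] comes from a punctured neighbourhood, so the value [a] itself is treated apart. *)
have [->|sa] := eqVneq (Num.max s 0) a; first by rewrite subrr normr0.
apply: H => //=; last by rewrite le_max lexx orbT.
apply: le_lt_trans ts.
rewrite /a; case: (lerP t 0) => t0; case: (lerP s 0) => s0.
- by rewrite subrr normr0.
- rewrite sub0r normrN gtr0_norm// ler0_norm; lra.
- rewrite subr0 gtr0_norm// ger0_norm; lra.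
- by [].
Qed.

Lemma halfline_primitive (f : R -> R) :
  (forall t, 0 <= t -> exists v, has_derivative f t v) ->
  exists F, forall t, 0 <= t -> has_derivative F t (f t).
Proof.
move=> /halfline_extension_continuous; set g := (fun s => _) => cg.
(* Integrating from -1 makes every t >= 0 an interior point. *)
exists (fun x => (\int[lebesgue_measure]_(t in [set` `[(-1), x]]) g t)%R).
move=> t t0; apply: is_derive_has_derivative.
have tt : t < t + 1 by lra.
have [] := @continuous_FTC1 R g (BLeft (-1)) t (t + 1) tt.
- apply: continuous_compact_integrable; first exact: segment_compact.
  exact: continuous_subspaceT.
- by rewrite lte_fin; lra.
- exact: cg.
move=> dF Ft; split => //.
by rewrite -derive1E Ft /g max_l.
Qed.

End HalfLineDerivative.

(** * Scalar linear equations with constant coefficients *)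

Section Jets.
Context {R : realType}.
Implicit Types (a b t : R) (f g z w : nat -> R -> R) (p q : {poly R}).

(** Carrying all derivatives along as data turns differentiation into an index shift, and
    differential operators into polynomials. *)
Definition jet g : Prop :=
  forall k t, 0 <= t -> has_derivative (g k) t (g k.+1 t).

(* [jet_eval (z^~ t) p] is the value at [t] of p(d/dt) applied to [z 0]. *)
Definition jet_eval (x : nat -> R) p : R := \sum_(l < size p) p`_l * x l.

Lemma jet_evalE (x : nat -> R) p m : (size p <= m)%N ->
  jet_eval x p = \sum_(l < m) p`_l * x l.
Proof.
move=> pm; rewrite /jet_eval (big_ord_widen m (fun l => p`_l * x l) pm).
rewrite big_mkcond/=; apply: eq_bigr => l _; case: ltnP => // pl.
by rewrite nth_default ?mul0r.
Qed.

Lemma jet_eval_linear (x : nat -> R) : scalar (jet_eval x).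
Proof.
move=> c p q; set m := maxn (size (c *: p + q)) (maxn (size p) (size q)).
rewrite !(@jet_evalE x _ m); try by rewrite /m !leq_max leqnn ?orbT.
rewrite mulr_sumr -big_split; apply: eq_bigr => l _.
by rewrite coefD coefZ mulrDl mulrA.
Qed.

HB.instance Definition _ (x : nat -> R) :=
  GRing.isLinear.Build R {poly R} R *%R (jet_eval x) (jet_eval_linear x).

Lemma jet_evalZ (x : nat -> R) c p : jet_eval x (c *: p) = c * jet_eval x p.
Proof. exact: linearZ. Qed.

Lemma jet_evalXn (x : nat -> R) k : jet_eval x 'X^k = x k.
Proof.
rewrite /jet_eval size_polyXn big_ord_recr/= coefXn eqxx mul1r big1 ?add0r//.
by move=> i _; rewrite coefXn ltn_eqF ?mul0r.
Qed.

Lemma has_derivative_jet_eval z p t : jet z -> 0 <= t ->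
  has_derivative (fun s => jet_eval (z^~ s) p) t (jet_eval (z^~ t) (p * 'X)).
Proof.
move=> jz t0.
rewrite (@jet_evalE _ (p * 'X) (size p).+1); last first.
  by apply: leq_trans (size_polyMleq _ _) _; rewrite size_polyX addn2.
(* The constant coefficient of [p * 'X] is 0; the remaining terms are those of [p] with the
   derivative order raised by one. *)
rewrite big_ord_recl coefMX mul0r add0r.
apply: has_derivative_sum => l; rewrite coefMX /=.
by apply: has_derivativeMl; exact: jz.
Qed.

(** The equation is imposed on derivatives of every order, so that the solution for one factor can
    serve as the forcing of the next. *)
Definition ode_solvable p : Prop := forall f, jet f -> exists z,
  jet z /\ forall k t, 0 <= t -> jet_eval (z^~ t) (p * 'X^k) = f k t.

(** First [p] is solved for [w] with forcing [f], then [q] for [z] with forcing [w]. *)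
Lemma ode_solvableM p q :
  ode_solvable p -> ode_solvable q -> ode_solvable (p * q).
Proof.
move=> sp sq f /sp[w [jw wf]]; have [z [jz zw]] := sq _ jw.
exists z; split => // k t t0; rewrite -wf// [p * q]mulrC -mulrA.
(* Expanding [r] into monomials reduces the claim to the equations [zw], one for each power of
   ['X]. *)
move: (p * 'X^k) => r; rewrite -{1}[r]coefK poly_def mulr_sumr linear_sum/=.
by apply: eq_bigr => i _; rewrite -scalerAr jet_evalZ zw.
Qed.

Lemma ode_solvableC c : c != 0 -> ode_solvable c%:P.
Proof.
move=> c0 f jf; exists (fun k s => c^-1 * f k s); split => [k t t0|k t t0].
  by apply: has_derivativeMl; exact: jf.
by rewrite mul_polyC jet_evalZ jet_evalXn mulVKf.
Qed.

Lemma is_derive_scale a t : is_derive t 1 ( *%R a) a.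
Proof.
apply: (@is_derive_eq _ _ _ _ _ _ _ _ (is_deriveZ a (is_derive_id t 1))).
by rewrite /GRing.scale/= mulr1.
Qed.

Lemma has_derivative_expM a t :
  has_derivative (fun s => expR (a * s)) t (a * expR (a * t)).
Proof.
apply: is_derive_has_derivative.
have H := is_derive_scale a t.
by have := is_derive1_comp (is_derive_expR (a * t)) H; rewrite mulrC.
Qed.

Lemma has_derivative_cosM b t :
  has_derivative (fun s => cos (b * s)) t (- b * sin (b * t)).
Proof.
apply: is_derive_has_derivative.
have H := is_derive_scale b t.
have := is_derive1_comp (is_derive_cos (b * t)) H.
by rewrite mulrC mulrN mulNr.
Qed.

Lemma has_derivative_sinM b t :
  has_derivative (fun s => sin (b * s)) t (b * cos (b * t)).
Proof.
apply: is_derive_has_derivative.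
have H := is_derive_scale b t.
by have := is_derive1_comp (is_derive_sin (b * t)) H; rewrite mulrC.
Qed.

Arguments has_derivative_expM a t : clear implicits.
Arguments has_derivative_cosM b t : clear implicits.
Arguments has_derivative_sinM b t : clear implicits.

Lemma ode_solvable_XsubC a : ode_solvable ('X - a%:P).
Proof.
move=> f jf.
have [|F dF] := @halfline_primitive R (fun s => expR (- a * s) * f 0%N s).
  move=> t t0; eexists; apply: has_derivativeM; last exact: jf.
  exact: has_derivative_expM.
(* Order 0 is the variation of constants formula. Higher orders are read off the equation, which
   then holds by construction. *)
pose z := fix z k s := if k is k'.+1 then a * z k' s + f k' s
                       else expR (a * s) * F s.
exists z; split.
  elim=> [|k ih] t t0.
    have := has_derivativeM (has_derivative_expM a t) (dF t t0).
    congr has_derivative => /=.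
    rewrite mulrA -expRD mulNr subrr expR0; ring.
  by apply: has_derivativeD; [apply: has_derivativeMl; exact: ih|exact: jf].
move=> k t t0; rewrite mulrBl -exprS mul_polyC linearB/= jet_evalZ !jet_evalXn.
by rewrite /= addrAC subrr add0r.
Qed.

(** With [y = (x' - a x) / b] the equation becomes a planar first-order system whose homogeneous
    flow is [expR (a * t)] times a rotation of angle [b * t]. *)
Lemma ode_solvable_quadratic a b : b != 0 ->
  ode_solvable (('X - a%:P) ^+ 2 + (b ^+ 2)%:P).
Proof.
move=> b0 f jf.
(* [U] and [V] integrate the forcing vector (0, f / b) pulled back by the inverse flow. *)
have [|U dU] := @halfline_primitive R
    (fun s => - b^-1 * (sin (b * s) * (expR (- a * s) * f 0%N s))).
  move=> t t0; eexists; apply: has_derivativeMl; apply: has_derivativeM.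
    exact: has_derivative_sinM.
  by apply: has_derivativeM; [exact: has_derivative_expM|exact: jf].
have [|V dV] := @halfline_primitive R
    (fun s => b^-1 * (cos (b * s) * (expR (- a * s) * f 0%N s))).
  move=> t t0; eexists; apply: has_derivativeMl; apply: has_derivativeM.
    exact: has_derivative_cosM.
  by apply: has_derivativeM; [exact: has_derivative_expM|exact: jf].
(* Variation of constants for x' = a x + b y, y' = a y - b x + f / b. *)
pose x s := expR (a * s) * (cos (b * s) * U s + sin (b * s) * V s).
pose y s := expR (a * s) * (cos (b * s) * V s - sin (b * s) * U s).
have ee t : expR (- a * t) = (expR (a * t))^-1 by rewrite mulNr expRN.
have e0 t : expR (a * t) != 0 by rewrite gt_eqF ?expR_gt0.
have dx t : 0 <= t -> has_derivative x t (a * x t + b * y t).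
  move=> t0; have dC := has_derivative_cosM b t.
  have dS := has_derivative_sinM b t.
  have := has_derivativeM (has_derivative_expM a t)
    (has_derivativeD (has_derivativeM dC (dU t t0))
                     (has_derivativeM dS (dV t t0))).
  congr has_derivative; rewrite /x /y; ring.
have dy t : 0 <= t -> has_derivative y t (a * y t - b * x t + b^-1 * f 0%N t).
  move=> t0; have dC := has_derivative_cosM b t.
  have dS := has_derivative_sinM b t.
  have := has_derivativeM (has_derivative_expM a t)
    (has_derivativeD (has_derivativeM dC (dV t t0))
      (has_derivativeN (has_derivativeM dS (dU t t0)))).
  congr has_derivative; rewrite /x /y ee.
  (* The derivatives of [U] and [V] produce the forcing multiplied by [cos ^+ 2 + sin ^+ 2]. *)
  have -> : b^-1 * f 0%N t =
      b^-1 * f 0%N t * (cos (b * t) ^+ 2 + sin (b * t) ^+ 2).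
    by rewrite cos2Dsin2 mulr1.
  by field; rewrite b0 e0.
pose c := a ^+ 2 + b ^+ 2.
(* The jet starts with [x] and its derivative; from order 2 on, the equation is solved for its top
   derivative. *)
pose z := fix z k : R -> R := if k is k1.+1 then
    if k1 is k2.+1 then fun s => 2 * a * z k1 s - c * z k2 s + f k2 s
    else fun s => a * x s + b * y s
  else x.
exists z; split.
  (* The recursion has order two, so the induction carries two consecutive orders. *)
  suff H k : (forall t, 0 <= t -> has_derivative (z k) t (z k.+1 t)) /\
             (forall t, 0 <= t -> has_derivative (z k.+1) t (z k.+2 t)).
    by move=> k; exact: (H k).1.
  elim: k => [|k [ih1 ih2]]; split => //= t t0.
  - have := has_derivativeD
      (has_derivativeMl (c := a) (dx t t0))
      (has_derivativeMl (c := b) (dy t t0)).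
    congr has_derivative; rewrite /c; field; exact: b0.
  - apply: has_derivativeD; last exact: jf.
    apply: has_derivativeD; first by apply: has_derivativeMl; exact: ih2.
    by apply: has_derivativeN; apply: has_derivativeMl; exact: ih1.
move=> k t t0.
have -> : (('X - a%:P) ^+ 2 + (b ^+ 2)%:P) * 'X^k =
    'X^(k.+2) - (2 * a) *: 'X^(k.+1) + c *: 'X^k.
  by rewrite -!mul_polyC /c !rmorphE/= !exprS; ring.
rewrite linearD linearB/= !jet_evalZ !jet_evalXn/=; ring.
Qed.

(** A root [a + i b] exists over the algebraically closed [R[i]]. If [b] is nonzero, the remainder
    of [p] modulo the real quadratic vanishing there has degree at most 1 and a nonreal root, so it
    is 0. *)
Lemma real_poly_factor p : (1 < size p)%N ->
  (exists a, root p a) \/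
  exists a b, b != 0 /\ ('X - a%:P) ^+ 2 + (b ^+ 2)%:P %| p.
Proof.
move=> p1; pose C := (real_complex R : R -> R[i]).
have /closed_rootP[[a b] pz] : size (map_poly C p) != 1%N.
  by rewrite size_map_poly gtn_eqF.
have [b0|b0] := eqVneq b 0.
  left; exists a; move: pz; rewrite b0 -[(_ +i* _)%C]/(C a) fmorph_root//.
right; exists a, b; split=> //.
set q := _ + _.
have sq : size q = 3%N.
  by rewrite size_polyDl ?size_exp_XsubC// size_polyC; case: eqP.
have q0 : q != 0 by rewrite -size_poly_eq0 sq.
have qz : (map_poly C q).[(a +i* b)%C] = 0.
  rewrite rmorphD rmorphXn rmorphB/= map_polyX !map_polyC/= !hornerE.
  apply/eqP; rewrite eq_complex/= /C; apply/andP; split; apply/eqP => /=; ring.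
rewrite /dvdp; set r := p %% q.
have sr : (size r <= 2)%N by have := ltn_modp p q; rewrite q0 sq.
have rz : (map_poly C r).[(a +i* b)%C] = 0.
  have := pz; rewrite /root {1}(divp_eq p q) rmorphD rmorphM/= hornerD hornerM.
  by rewrite qz mulr0 add0r => /eqP.
have rE : r = r`_1 *: 'X + (r`_0)%:P.
  apply/polyP => i; rewrite coefD coefZ coefX coefC.
  case: i => [|[|i]] /=; rewrite ?mulr0 ?mulr1 ?add0r ?addr0//.
  by rewrite nth_default// (leq_trans sr).
move: rz; rewrite {1}rE -mul_polyC rmorphD rmorphM/= !map_polyC/= map_polyX.
rewrite !hornerE.
move=> /eqP; rewrite eq_complex/= => /andP[/eqP ra /eqP rb].
(* The imaginary part of the evaluation is the leading coefficient times [b]. *)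
have r1 : r`_1 = 0.
  by apply/eqP; rewrite -(mulIr_eq0 _ (mulIf b0)); apply/eqP; move: rb; lra.
have r00 : r`_0 = 0 by move: ra; rewrite r1; lra.
by rewrite rE r1 r00 scale0r add0r polyC0.
Qed.

(** Strong induction on the size: a real linear or quadratic factor is split off, and the cofactor
    is strictly smaller. *)
Lemma ode_solvable_neq0 p : p != 0 -> ode_solvable p.
Proof.
have [m] := ubnP (size p); elim: m p => // m ih p pm p0.
have [p1|p1] := leqP (size p) 1.
  rewrite (size1_polyC p1); apply: ode_solvableC.
  by move: p0; rewrite (size1_polyC p1) polyC_eq0 coefC.
have factor q : (1 < size q)%N -> ode_solvable q -> q %| p -> ode_solvable p.
  move=> sq solq /dvdpP[r pE].
  have r0 : r != 0 by apply: contraNneq p0 => r0; rewrite pE r0 mul0r.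
  have q0 : q != 0 by rewrite -size_poly_gt0 (leq_trans _ sq).
  rewrite pE; apply: ode_solvableM => //; apply: ih => //.
  move: sq pm; rewrite pE size_mul//; move: r0; rewrite -size_poly_gt0.
  by case: (size r) (size q) => [|i] [|[|j]]//= _ _; rewrite addnS/=; lia.
have [[a pa]|[a [b [b0 pab]]]] := real_poly_factor p1.
  apply: (factor ('X - a%:P)); first by rewrite size_XsubC.
    exact: ode_solvable_XsubC.
  by rewrite dvdp_XsubCl.
apply: (factor _ _ (ode_solvable_quadratic a b0) pab).
by rewrite size_polyDl ?size_exp_XsubC// size_polyC; case: eqP.
Qed.

End Jets.

(** * Trajectories of regular pencils and transfer of attacks between monitoring signals *)

Section RegularPencil.
Context {R : realType}.

Lemma smooth_signal_mulmx m n q (M : 'M[R]_(m, n)) (u : R -> 'M[R]_(n, q)) :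
  smooth_signal u -> smooth_signal (fun t => M *m u t).
Proof.
move=> [g [<- dg]]; exists (fun k t => M *m g k t); split => // k t t0.
by apply: has_derivative_mulmx; exact: dg.
Qed.

Lemma smooth_signalD (V : normedModType R) (u v : R -> V) :
  smooth_signal u -> smooth_signal v -> smooth_signal (fun t => u t + v t).
Proof.
move=> [g [<- dg]] [h [<- dh]].
exists (fun k t => g k t + h k t); split => // k t t0.
by apply: has_derivativeD; [exact: dg|exact: dh].
Qed.

Lemma smooth_signal0 (V : normedModType R) : smooth_signal (fun=> 0 : V).
Proof.
exists (fun _ _ => 0); split => // k t t0; exact: has_derivative_cst.
Qed.

Lemma smooth_state_input n p (K : {set 'I_(n + p)}) (u : R -> 'cV[R]_#|K|)
    (w : R -> 'cV[R]_(n + p)) :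
  smooth_signal u -> smooth_signal w -> smooth_signal (state_input u w).
Proof.
move=> su sw; apply: smooth_signalD; first exact: smooth_signal_mulmx.
have -> : (fun t => usubmx (w t)) = (fun t => row_mx 1%:M 0 *m w t).
  by apply/funext => t; rewrite -{2}[w t]vsubmxK mul_row_col mul1mx mul0mx
    addr0.
exact: smooth_signal_mulmx.
Qed.

Lemma regular_trajectory n (E A : 'M[R]_n) (f : R -> 'cV[R]_n) :
  regular_pencil E A -> smooth_signal f ->
  exists x0 x, state_trajectory E A x0 f x.
Proof.
rewrite /regular_pencil; set M := _ - _ => M0 [g [<- dg]].
have [z jz] : exists z : 'I_n -> nat -> R -> R, forall j, jet (z j) /\
    forall t, 0 <= t -> jet_eval ((z j)^~ t) (\det M) = g 0%N t j 0.
  suff H j : exists z, jet z /\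
      forall t, 0 <= t -> jet_eval (z^~ t) (\det M) = g 0%N t j 0.
    by have [z Hz] := choice H; exists z.
  have [|z [jz zg]] := ode_solvable_neq0 M0 (f := fun k t => g k t j 0).
    by move=> k t t0; have /has_derivative_mxP/(_ j 0) := dg k t t0.
  by exists z; split => // t t0; have := zg 0%N t t0; rewrite expr0 mulr1.
(* The adjugate, read as a matrix of differential operators, is applied to [z]; the initial state is
   whatever this yields at time 0. *)
pose x t : 'cV[R]_n := \col_i \sum_j jet_eval ((z j)^~ t) (\adj M i j).
pose dx t : 'cV[R]_n := \col_i \sum_j jet_eval ((z j)^~ t) (\adj M i j * 'X).
exists (x 0), x; split => // t t0; exists (dx t); split.
  apply/has_derivative_mxP => i j; rewrite mxE; under eq_fun do rewrite mxE.
  apply: has_derivative_sum => k.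
  by apply: has_derivative_jet_eval => //; exact: (jz k).1.
apply/eqP; rewrite addrC -subr_eq; apply/eqP/colP => i.
rewrite -(jz i).2// !mxE -sumrB.
(* By linearity, [E *m dx t - A *m x t] is the operator [M *m \adj M] applied to [z]; this product
   is [\det M] on the diagonal and 0 elsewhere. *)
transitivity (\sum_j jet_eval ((z j)^~ t) ((M *m \adj M) i j)).
  under [RHS]eq_bigr do rewrite mxE linear_sum/=.
  rewrite exchange_big/=; apply: eq_bigr => l _.
  rewrite !mxE !mulr_sumr -sumrB; apply: eq_bigr => j _.
  rewrite -!jet_evalZ -linearB/=; congr jet_eval.
  by rewrite -!mul_polyC; ring.
rewrite mul_mx_adj (bigD1 i)//= mxE eqxx mulr1n big1 ?addr0// => j ji.
by rewrite mxE eq_sym (negPf ji) mulr0n linear0.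
Qed.

(** At time 0 the equation puts [A *m x0 + f 0] in the range of [E], which is orthogonal to the
    kernel of [E^T]. *)
Lemma trajectory_consistent n (E A : 'M[R]_n) x0 f x :
  state_trajectory E A x0 f x -> consistent E A x0 f.
Proof.
move=> [<- /(_ 0 (lexx _))[dx [_ Edx]]] v Ev.
by rewrite -Edx mulmxA -[v^T *m E]trmxK trmx_mul trmxK Ev trmx0 mul0mx.
Qed.

Lemma output_collision_transfer n p (E A : 'M[R]_n) (C : 'M[R]_(p, n))
    (K K' : {set 'I_(n + p)}) (u : R -> 'cV[R]_#|K|) (u' : R -> 'cV[R]_#|K'|)
    (w w' : R -> 'cV[R]_(n + p)) :
  regular_pencil E A -> smooth_signal u' -> smooth_signal w' ->
  (exists (x xbar : 'cV[R]_n) (y : R -> 'cV[R]_p),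
    generates_output E A C x u w y /\ generates_output E A C xbar u' w y) ->
  exists (x xbar : 'cV[R]_n) (y : R -> 'cV[R]_p),
    generates_output E A C x u w' y /\ generates_output E A C xbar u' w' y.
Proof.
move=> hreg su' sw' [x0 [xb0 [y [[_ [x [[_ dx] yx]]] [_ [xb [[_ dxb] yxb]]]]]]].
have [z0 [z tz]] := regular_trajectory hreg (smooth_state_input su' sw').
(* In the difference [x - xb] the signal [w] cancels and the input of [u] minus that of [u']
   remains; adding [z], driven by [u'] and [w'], leaves [u] and [w']. *)
pose v t := z t + (x t - xb t).
have tv : state_trajectory E A (v 0) (state_input u w') v.
  split=> // t t0.
  have [d [hd Ed]] := dx t t0; have [db [hdb Edb]] := dxb t t0.
  have [dz [hdz Edz]] := tz.2 t t0.
  exists (dz + (d - db)); split.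
    by apply: has_derivativeD => //; apply: has_derivativeD => //;
      exact: has_derivativeN.
  rewrite !mulmxDr !mulmxN Ed Edb Edz /state_input.
  move: (A *m z t) (A *m x t) (A *m xb t) (usubmx (w t)) (usubmx (w' t))
    => a b c d1 d2.
  move: (_ *m u t) (_ *m u' t) => e1 e2.
  by apply/matrixP => i j; rewrite !mxE; ring.
(* The common output is that of [z]; [v] reproduces it because the original outputs under [w]
   coincide. *)
exists (v 0), z0, (fun t => C *m z t + output_input u' w' t); split.
  split; first exact: trajectory_consistent tv.
  exists v; split => // t t0.
  have := yx t t0; rewrite yxb// /v !mulmxDr mulmxN /output_input.
  move: (C *m z t) (C *m x t) (C *m xb t) (dsubmx (w t)) (dsubmx (w' t))
    => a b c d1 d2.
  move: (_ *m u t) (_ *m u' t) => e1 e2 /matrixP H.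
  by apply/matrixP => i j; have := H i j; rewrite !mxE; lra.
by split; [exact: trajectory_consistent tz|exists z].
Qed.

(** Undetectability is an output collision with the zero attack, which is smooth. *)
Lemma undetectable_transfer n p (E A : 'M[R]_n) (C : 'M[R]_(p, n))
    (K : {set 'I_(n + p)}) (u : R -> 'cV[R]_#|K|) (w w' : R -> 'cV[R]_(n + p)) :
  regular_pencil E A -> smooth_signal w' ->
  undetectable E A C w u -> undetectable E A C w' u.
Proof.
move=> hreg sw' [au [nu H]]; split => //; split => //.
by apply: output_collision_transfer H => //; exact: smooth_signal0.
Qed.

Lemma unidentifiable_transfer n p (E A : 'M[R]_n) (C : 'M[R]_(p, n))
    (K : {set 'I_(n + p)}) (u : R -> 'cV[R]_#|K|) (w w' : R -> 'cV[R]_(n + p)) :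
  regular_pencil E A -> smooth_signal w' ->
  unidentifiable E A C w u -> unidentifiable E A C w' u.
Proof.
move=> hreg sw' [au [nu [K' [u' [KK [nK [au' H]]]]]]].
split => //; split => //; exists K', u'; do 3 split => //.
by apply: output_collision_transfer H => //; exact: au'.1.
Qed.

End RegularPencil.

Theorem mainTheorem5 (R : realType) (n p : nat) (E A : 'M[R]_n)
    (C : 'M[R]_(p, n)) (K : {set 'I_(n + p)}) (hreg : regular_pencil E A) :
  (forall w w' : R -> 'cV[R]_(n + p), smooth_signal w -> smooth_signal w' ->
     ((exists u : R -> 'cV[R]_#|K|, undetectable E A C w u) <->
      (exists u : R -> 'cV[R]_#|K|, undetectable E A C w' u))) /\
  (forall w w' : R -> 'cV[R]_(n + p), smooth_signal w -> smooth_signal w' ->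
     ((exists u : R -> 'cV[R]_#|K|, unidentifiable E A C w u) <->
      (exists u : R -> 'cV[R]_#|K|, unidentifiable E A C w' u))) /\
  ((exists (w : R -> 'cV[R]_(n + p)) (u : R -> 'cV[R]_#|K|),
      smooth_signal w /\ undetectable E A C w u) ->
   exists u : R -> 'cV[R]_#|K|, forall w : R -> 'cV[R]_(n + p),
      smooth_signal w -> undetectable E A C w u) /\
  ((exists (w : R -> 'cV[R]_(n + p)) (u : R -> 'cV[R]_#|K|),
      smooth_signal w /\ unidentifiable E A C w u) ->
   exists u : R -> 'cV[R]_#|K|, forall w : R -> 'cV[R]_(n + p),
      smooth_signal w -> unidentifiable E A C w u).
Proof.
(* Each claim reuses the given attack [u] unchanged, which gives the equivalences and the
   independence of [w] alike. *)
split; [|split; [|split]].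
- move=> w w' sw sw'; split=> -[u Hu]; exists u;
    exact: undetectable_transfer Hu.
- move=> w w' sw sw'; split=> -[u Hu]; exists u;
    exact: unidentifiable_transfer Hu.
- move=> [w [u [_ Hu]]]; exists u => w' sw'; exact: undetectable_transfer Hu.
- move=> [w [u [_ Hu]]]; exists u => w' sw'; exact: unidentifiable_transfer Hu.
Qed.
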